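(* Let $R_n(w)=\sum_{m=0}^{n}A_mw^m$ be a right quaternionic polynomial with $A_m\in\mathbb{H}$. The quaternion $w_0$ is a spherical root of the polynomial $R_n(w)$ if and only if $$\sum_{m=1}^{n}A_mQ_m(w_0)=0.$$
   Context: $\mathbb{H}=\{x_0+x_1i+x_2j+x_3k : x_0,x_1,x_2,x_3\in\mathbb{R}\}$ is the skew field of real quaternions, with $i^2=j^2=k^2=-1$, $ij=-ji=k$, $jk=-kj=i$, $ki=-ik=j$. For $w=x_0+x_1i+x_2j+x_3k$ put $\mathrm{Sc}(w)=x_0$, $\mathrm{Vec}(w)=x_1i+x_2j+x_3k$, $|w|=\sqrt{x_0^2+x_1^2+x_2^2+x_3^2}$. A root of $R_n$ is a quaternion $w$ with $\sum_{m=0}^{n}A_mw^m=0$. The quaternion $w=x_0+\mathrm{Vec}(w)$ is called a spherical root of $R_n$ if any quaternion of the form $w_1=x_0+\mathrm{Vec}(w_1)$ with $|\mathrm{Vec}(w_1)|=|\mathrm{Vec}(w)|$ is also a root of $R_n$. The real numbers $Q_m(w)=Q_m(x_0,|w|^2)$ and $P_m(w)=P_m(x_0,|w|^2)$, where $x_0=\mathrm{Sc}(w)$, are the coefficients in the formula $w^m=Q_m(w)\,w-P_m(w)\,|w|^2$. They are given for $m\ge 1$ by $Q_1(w)=1$, $P_1(w)=0$, and, for $m\ge 2$, by the recurrences $Q_m(w)=2x_0Q_{m-1}(w)-P_{m-1}(w)|w|^2$ and $P_m(w)=Q_{m-1}(w)$.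
   Formalization: The formal theorem assumes that w_0 is a root of R_n and is not real; without these the claim fails, e.g. R(w)=w^2+5 at w_0=i (the sum is 0, but i is not a root) and R(w)=w at w_0=0 (spherical by the definition, but the sum is 1). *)

(* Defs.v *)
From HB Require Import structures.
From mathcomp Require Import all_boot all_order all_algebra.
From mathcomp Require Import reals.
From mathcomp Require Import ring.

Set Implicit Arguments.
Unset Strict Implicit.
Unset Printing Implicit Defensive.

Import Order.TTheory GRing.Theory Num.Theory.
Local Open Scope ring_scope.

Record quat (R : realType) : Type :=
  Quat { q0 : R; q1 : R; q2 : R; q3 : R }.

Section QuatRing.
Variable R : realType.
Implicit Types u v w : quat R.

Definition quat_to_prod u : R * R * R * R := (q0 u, q1 u, q2 u, q3 u).
Definition prod_to_quat (t : R * R * R * R) : quat R :=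
  let: (a, b, c, d) := t in Quat a b c d.

Lemma quat_to_prodK : cancel quat_to_prod prod_to_quat.
Proof. by case. Qed.

HB.instance Definition _ := Choice.copy (quat R) (can_type quat_to_prodK).

Definition quat_zero : quat R := Quat 0 0 0 0.
Definition quat_one : quat R := Quat 1 0 0 0.
Definition quat_opp u := Quat (- q0 u) (- q1 u) (- q2 u) (- q3 u).
Definition quat_add u v :=
  Quat (q0 u + q0 v) (q1 u + q1 v) (q2 u + q2 v) (q3 u + q3 v).
(* The bilinear product with i^2 = j^2 = k^2 = -1, ij = -ji = k,
   jk = -kj = i and ki = -ik = j. *)
Definition quat_mul u v :=
  Quat (q0 u * q0 v - q1 u * q1 v - q2 u * q2 v - q3 u * q3 v)
       (q0 u * q1 v + q1 u * q0 v + q2 u * q3 v - q3 u * q2 v)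
       (q0 u * q2 v - q1 u * q3 v + q2 u * q0 v + q3 u * q1 v)
       (q0 u * q3 v + q1 u * q2 v - q2 u * q1 v + q3 u * q0 v).

Lemma quat_addA : associative quat_add.
Proof. by move=> u v w; congr Quat; rewrite /= addrA. Qed.
Lemma quat_addC : commutative quat_add.
Proof. by move=> u v; congr Quat; rewrite /= addrC. Qed.
Lemma quat_add0 : left_id quat_zero quat_add.
Proof. by case=> a b c d; congr Quat; rewrite /= add0r. Qed.
Lemma quat_addN : left_inverse quat_zero quat_opp quat_add.
Proof. by move=> u; congr Quat; rewrite /= addNr. Qed.

HB.instance Definition _ :=
  GRing.isZmodule.Build (quat R) quat_addA quat_addC quat_add0 quat_addN.

Lemma quat_mulA : associative quat_mul.
Proof. by move=> u v w; congr Quat => /=; ring. Qed.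
Lemma quat_mul1q : left_id quat_one quat_mul.
Proof. by case=> a b c d; congr Quat => /=; ring. Qed.
Lemma quat_mulq1 : right_id quat_one quat_mul.
Proof. by case=> a b c d; congr Quat => /=; ring. Qed.
Lemma quat_mulDl : left_distributive quat_mul quat_add.
Proof. by move=> u v w; congr Quat => /=; ring. Qed.
Lemma quat_mulDr : right_distributive quat_mul quat_add.
Proof. by move=> u v w; congr Quat => /=; ring. Qed.
Lemma quat_one_neq0 : quat_one != 0.
Proof. by apply/eqP => -[] /eqP; rewrite oner_eq0. Qed.

HB.instance Definition _ := GRing.Zmodule_isNzRing.Build (quat R)
  quat_mulA quat_mul1q quat_mulq1 quat_mulDl quat_mulDr quat_one_neq0.

End QuatRing.

Definition qreal (R : realType) (x : R) : quat R := Quat x 0 0 0.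

Definition Sc (R : realType) (w : quat R) : R := q0 w.

Definition Vec (R : realType) (w : quat R) : quat R :=
  Quat 0 (q1 w) (q2 w) (q3 w).

Definition qabs (R : realType) (w : quat R) : R :=
  Num.sqrt (q0 w ^+ 2 + q1 w ^+ 2 + q2 w ^+ 2 + q3 w ^+ 2).

(* The pair (Q_m, P_m) as a function of x0 = Sc w and N = |w|^2.
   It is meaningful only for m >= 1; the value at m = 0 is never used. *)
Fixpoint QP (R : realType) (x0 N : R) (m : nat) : R * R :=
  match m with
  | 0%N => (0, 0)
  | 1%N => (1, 0)
  | m'.+1 => let: (q, p) := QP x0 N m' in (2 * x0 * q - p * N, q)
  end.

Definition Qcoef (R : realType) (m : nat) (w : quat R) : R :=
  (QP (Sc w) (qabs w ^+ 2) m).1.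

Definition Pcoef (R : realType) (m : nat) (w : quat R) : R :=
  (QP (Sc w) (qabs w ^+ 2) m).2.

(* Only the coefficients A 0, ..., A n matter; A n may vanish. *)
Definition qpoly_eval (R : realType) (n : nat) (A : nat -> quat R)
    (w : quat R) : quat R :=
  \sum_(0 <= m < n.+1) A m * w ^+ m.

Definition qpoly_root (R : realType) (n : nat) (A : nat -> quat R)
    (w : quat R) : Prop :=
  qpoly_eval n A w = 0.

(* Taking w1 := w shows that a spherical root is a root.  If w is real, the
   sphere degenerates to the single point w. *)
Definition spherical_root (R : realType) (n : nat) (A : nat -> quat R)
    (w : quat R) : Prop :=
  forall w1 : quat R,
    Sc w1 = Sc w -> qabs (Vec w1) = qabs (Vec w) -> qpoly_root n A w1.

(* Main.v *)
Require Import Defs.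
From mathcomp Require Import all_boot all_order all_algebra.
From mathcomp Require Import reals ring.
Import Order.TTheory GRing.Theory Num.Theory.
Local Open Scope ring_scope.

(** Why the theorem holds. Every quaternion satisfies the real quadratic
    equation w^2 = 2 Sc(w) w - |w|^2, so w^m = Q_m w - P_m |w|^2, where Q_m,
    P_m and |w|^2 depend only on the sphere through w, that is on Sc(w) and
    |Vec(w)| ([quat_expE]). For two points w and w' of one sphere the
    constant terms cancel and w^m - w'^m = Q_m (w - w'); hence, with
    S = sum A_m Q_m taken on that sphere, R(w) - R(w') = S (w - w')
    ([qpoly_eval_sub]).

    If S = 0, the polynomial is constant on the sphere of w0, and this constant
    is R(w0) = 0. Conversely, the conjugate of w0 lies on this sphere and
    differs from w0 by 2 Vec(w0). When both are roots, S (2 Vec(w0)) = 0, and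
    S = 0 because a nonzero quaternion is not a zero divisor
    ([quat_mulr_eq0]). *)

Definition qconj {R : realType} (w : quat R) : quat R :=
  Quat (q0 w) (- q1 w) (- q2 w) (- q3 w).

Lemma qabs_sqr {R : realType} (w : quat R) :
  qabs w ^+ 2 = q0 w ^+ 2 + q1 w ^+ 2 + q2 w ^+ 2 + q3 w ^+ 2.
Proof. by rewrite sqr_sqrtr // !addr_ge0 ?sqr_ge0. Qed.

Lemma qabs_eq0 {R : realType} (w : quat R) : qabs w ^+ 2 = 0 -> w = 0.
Proof.
case: w => a b c d; rewrite qabs_sqr /= => /eqP.
rewrite !paddr_eq0 ?addr_ge0 ?sqr_ge0 // !sqrf_eq0.
by case/andP => /andP[/andP[/eqP-> /eqP->] /eqP->] /eqP->.
Qed.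

Lemma qabs_Vec {R : realType} (w : quat R) :
  qabs w ^+ 2 = Sc w ^+ 2 + qabs (Vec w) ^+ 2.
Proof. by rewrite !qabs_sqr /Sc /=; ring. Qed.

Lemma quat_mul_conj {R : realType} (w : quat R) :
  w * qconj w = qreal (qabs w ^+ 2).
Proof.
by rewrite qabs_sqr; case: w => a b c d; congr Quat; rewrite /=; ring.
Qed.

(** Right multiplication by [w] is undone, up to the real factor |w|^2, by
    right multiplication by the conjugate of [w]. *)
Lemma quat_mulr_eq0 {R : realType} (u w : quat R) :
  w <> 0 -> u * w = 0 -> u = 0.
Proof.
move=> w_neq0 uw0.
have N_neq0 : qabs w ^+ 2 != 0 by apply/eqP => /qabs_eq0.
have NV : qreal (qabs w ^+ 2) * qreal (qabs w ^+ 2)^-1 = 1.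
  by congr Quat; rewrite /= ?mulfV ?mulr0 ?mul0r ?subr0 ?addr0.
by rewrite -[u]mulr1 -{}NV -quat_mul_conj !mulrA uw0 !mul0r.
Qed.

Lemma QP_rec {R : realType} (x0 N : R) (m : nat) :
  QP x0 N m.+2 =
  (2 * x0 * (QP x0 N m.+1).1 - (QP x0 N m.+1).2 * N, (QP x0 N m.+1).1).
Proof.
rewrite -[LHS]/(let: (q, p) := QP x0 N m.+1 in (2 * x0 * q - p * N, q)).
by case: (QP x0 N m.+1).
Qed.

(** The recurrences for [Qcoef] and [Pcoef] are exactly those obtained on
    multiplying [w ^+ m] by [w] and reducing with w^2 = 2 Sc(w) w - |w|^2. *)
Lemma quat_expE {R : realType} (m : nat) (w : quat R) : (0 < m)%N ->
  w ^+ m = qreal (Qcoef m w) * w - qreal (Pcoef m w * qabs w ^+ 2).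
Proof.
case: m => // m _; elim: m => [|m IHm].
  rewrite expr1 /Qcoef /Pcoef /= mul0r.
  by case: w => a b c d; congr Quat; rewrite /=; ring.
rewrite exprSr {}IHm /Qcoef /Pcoef QP_rec.
case: (QP _ _ m.+1) => q p; rewrite /= qabs_sqr /Sc.
by case: w => a b c d; congr Quat; rewrite /=; ring.
Qed.

(** On one sphere [qpoly_eval] is an affine function of the point, with left
    slope the sum of the [A m * Q_m]. The index 0 contributes only to its
    constant term. *)
Lemma qpoly_eval_sub {R : realType} (n : nat) (A : nat -> quat R)
    (w w' : quat R) :
  Sc w = Sc w' -> qabs (Vec w) = qabs (Vec w') ->
  qpoly_eval n A w - qpoly_eval n A w' =
  (\sum_(1 <= m < n.+1) A m * qreal (Qcoef m w')) * (w - w').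
Proof.
move=> eqS eqV; have eqN : qabs w ^+ 2 = qabs w' ^+ 2.
  by rewrite (qabs_Vec w) (qabs_Vec w') eqS eqV.
rewrite /qpoly_eval !(@big_ltn _ _ _ 0) // !expr0.
rewrite opprD addrACA subrr add0r -sumrB mulr_suml.
apply: eq_big_nat => m /andP[m_gt0 _].
rewrite -mulrBr -mulrA; congr (_ * _).
rewrite !quat_expE // /Qcoef /Pcoef eqS eqN.
by rewrite opprB addrA subrK mulrBr.
Qed.

Theorem theorem6 (R : realType) (n : nat) (A : nat -> quat R) (w0 : quat R)
    (w0_root : qpoly_root n A w0) (w0_nonreal : Vec w0 <> 0) :
  spherical_root n A w0 <->
  \sum_(1 <= m < n.+1) A m * qreal (Qcoef m w0) = 0.
Proof.
split=> [w0_spherical | S0 w1 eqS eqV]; last first.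
  have := qpoly_eval_sub n A w1 w0 eqS eqV.
  by rewrite S0 mul0r w0_root subr0.
have eqV : qabs (Vec (qconj w0)) = qabs (Vec w0) by rewrite /qabs /= !sqrrN.
have /esym := qpoly_eval_sub n A (qconj w0) w0 erefl eqV.
rewrite w0_root (w0_spherical (qconj w0) erefl eqV) subrr.
have -> : qconj w0 - w0 = Vec w0 * qreal (- 2).
  by case: w0 {w0_root w0_nonreal w0_spherical eqV} => a b c d;
    congr Quat; rewrite /=; ring.
rewrite mulrA => SV0; apply: (quat_mulr_eq0 _ _ w0_nonreal).
apply: (quat_mulr_eq0 _ _ _ SV0) => -[] /eqP.
by rewrite oppr_eq0 pnatr_eq0.
Qed.
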